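(* Let $G$ be a Hausdorff topological group, $K$ a subgroup of $G$ and $(X,\theta)$ a $K$-space. Then the map $\iota^\theta_K:X\to G\times_KX$, $x\mapsto[e,x]_K$, is injective and a $K$-isovariant map, where $G\times_KX$ is considered as a $K$-space by restricting the action $\mu^\theta_K$ to $K\times(G\times_KX)$. Moreover: (i) $\iota^\theta_K(X)$ is open (respectively closed) in $G\times_KX$ if and only if $K*X$ is open (respectively closed) in $G\times X$. (ii) The map $\iota^\theta_K:X\to\iota^\theta_K(X)$ is a homeomorphism (where $\iota^\theta_K(X)$ has the subspace topology). (iii) If $K=G$, then $\iota^\theta_G=\iota^\theta$, where $\iota^\theta:X\to X_G$, $x\mapsto[e,x]$, is the canonical map to the enveloping space (under the identity $G\times_GX=X_G$).
   Context: Partial actions. A partial action of a group $G$ (identity $e$) on a set $X$ is a map $\theta:G*X\to X$, $(g,x)\mapsto g\cdot x$, defined on a subset $G*X\subseteq G\times X$ (write $\exists\, g\cdot x$ for $(g,x)\in G*X$), such that for all $g,h\in G$, $x\in X$: (PA1) if $\exists\, g\cdot x$ then $\exists\, g^{-1}\cdot(g\cdot x)$ and $g^{-1}\cdot(g\cdot x)=x$; (PA2) if $\exists\, g\cdot(h\cdot x)$ then $\exists\,(gh)\cdot x$ and $g\cdot(h\cdot x)=(gh)\cdot x$; (PA3) $\exists\, e\cdot x$ and $e\cdot x=x$. It is global if $G*X=G\times X$. Put $X_g=\{x\in X:\exists\, g^{-1}\cdot x\}$, $\theta_g:X_{g^{-1}}\to X_g$, $x\mapsto g\cdot x$, and $G^x=\{g\in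 G:(g,x)\in G*X\}$. If $G$ is a topological group and $X$ a topological space, $\theta$ is topological if every $X_g$ is open in $X$ and every $\theta_g$ is a homeomorphism, and continuous if $\theta$ is continuous for the subspace topology on $G*X\subseteq G\times X$. All topological groups are Hausdorff and all partial actions are topological. A $G$-space is a pair $(X,\theta)$ with $\theta$ a continuous (topological) partial action of $G$ on the topological space $X$. A $G$-map $f:(X,\theta)\to(Y,\eta)$ is a continuous map such that for all $(g,x)\in G*X$ one has $(g,f(x))\in G*Y$ and $\eta(g,f(x))=f(\theta(g,x))$. The isotropy group of $x$ is $G_x=\{g\in G^x:\theta(g,x)=x\}$; a $G$-map $f$ is $G$-isovariant if $G_x=G_{f(x)}$ for all $x\in X$. Twisted product. For a subgroup $K\le G$ (subspace topology) and a $K$-space $(X,\theta)$, $G\times_KX$ is the quotient space of $G\times X$ by the equivalence relation whose classes are $[g,x]_K=\{(gk^{-1},\theta(k,x)):k\in K^x\}$, where $K^x=\{k\in K:(k,x)\in K*X\}$. The group $G$ acts on it globally and continuously by $\mu^\theta_K(g',[g,x]_K)=[g'g,x]_K$. Enveloping space. For a $G$-space $(X,\theta)$, $X_G=(G\times X)/R$ with the quotient topology, where $(g,x)R(h,y)$ iff $x\in X_{g^{-1}h}$ and $\theta_{h^{-1}g}(x)=y$; the class of $(g,x)$ is $[g,x]$. One has $[g,x]=[g,x]_G$, so $X_G=G\times_GX$. *)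

(* Defs.v *)
From HB Require Import structures.
From mathcomp Require Import all_boot all_order all_algebra.
From mathcomp Require Import all_classical all_reals topology.

Set Implicit Arguments.
Unset Strict Implicit.
Unset Printing Implicit Defensive.

Local Open Scope quotient_scope.
Local Open Scope classical_set_scope.
Local Open Scope group_scope.

HB.mixin Record Group_isTopologicalGroup G of Topological G & Group G := {
  mulg_continuous : continuous (fun p : G * G => p.1 * p.2);
  invg_continuous : continuous (fun g : G => g^-1)
}.

#[short(type="topologicalGroupType")]
HB.structure Definition TopologicalGroup :=
  {G of Topological G & Group G & Group_isTopologicalGroup G}.

Record subgroup (G : groupType) := Subgroup {
  subgroup_set : set G;
  subgroupP : group_closed [in subgroup_set]
}.

Section SubgroupTheory.
Context {G : groupType} (K : subgroup G).

Lemma subgroup1 : subgroup_set K 1.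
Proof. by have [/set_mem] := subgroupP K. Qed.

Lemma subgroupV g : subgroup_set K g -> subgroup_set K g^-1.
Proof. by move=> Kg; apply/set_mem/(group_closedV (subgroupP K))/mem_set. Qed.

Lemma subgroupM g h : subgroup_set K g -> subgroup_set K h ->
  subgroup_set K (g * h).
Proof.
by move=> Kg Kh; apply/set_mem/(group_closedM (subgroupP K)); exact: mem_set.
Qed.

End SubgroupTheory.

Lemma full_subgroup_subproof (G : groupType) : group_closed [in [set: G]].
Proof. by split=> [|g h _ _]; rewrite -topredE /= in_setT. Qed.

Definition full_subgroup (G : groupType) : subgroup G :=
  Subgroup (full_subgroup_subproof G).

(* The map restricts to a homeomorphism from A onto B, for the subspace
   topologies. *)
Definition homeomorphism_on (X Y : topologicalType) (A : set X) (B : set Y)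
    (f : X -> Y) : Prop :=
  exists g : Y -> X,
    [/\ set_fun A B f, set_fun B A g, {in A, cancel f g}, {in B, cancel g f} &
        {within A, continuous f} /\ {within B, continuous g}].

(* As with the actions of subgroups in fingroup, the acting group is a subgroup
   K of an ambient group G: pact_dom, which is K*X, is a subset of K x X inside
   G x X, and the values of pact outside pact_dom are irrelevant. *)
Record partial_action (G : groupType) (K : subgroup G) (X : Type) :=
  PartialAction {
  pact_dom : set (G * X);
  pact : G -> X -> X;
  pact_domS : forall g x, pact_dom (g, x) -> subgroup_set K g;
  pactVK : forall g x, pact_dom (g, x) ->
    pact_dom (g^-1, pact g x) /\ pact g^-1 (pact g x) = x;
  pactM : forall g h x, pact_dom (h, x) -> pact_dom (g, pact h x) ->
    pact_dom (g * h, x) /\ pact g (pact h x) = pact (g * h) x;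
  pact1 : forall x, pact_dom (1, x) /\ pact 1 x = x
}.

(* X_g *)
Definition pact_range (G : groupType) (K : subgroup G) (X : Type)
    (theta : partial_action K X) (g : G) : set X :=
  [set x | pact_dom theta (g^-1, x)].

Record gspace (G : topologicalGroupType) (K : subgroup G)
    (X : topologicalType) := GSpace {
  gspace_pact :> partial_action K X;
  gspace_open : forall g, subgroup_set K g -> open (pact_range gspace_pact g);
  gspace_homeo : forall g, subgroup_set K g ->
    homeomorphism_on (pact_range gspace_pact g^-1) (pact_range gspace_pact g)
      (pact gspace_pact g);
  gspace_continuous : {within pact_dom gspace_pact,
    continuous (fun p : G * X => pact gspace_pact p.1 p.2)}
}.

Definition isotropy (G : groupType) (K : subgroup G) (X : Type)
    (theta : partial_action K X) (x : X) : set G :=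
  [set g | pact_dom theta (g, x) /\ pact theta g x = x].

Definition gmap (G : topologicalGroupType) (K : subgroup G)
    (X Y : topologicalType) (theta : gspace K X) (eta : gspace K Y)
    (f : X -> Y) : Prop :=
  continuous f /\
  forall g x, pact_dom theta (g, x) ->
    pact_dom eta (g, f x) /\ pact eta g (f x) = f (pact theta g x).

Definition isovariant (G : topologicalGroupType) (K : subgroup G)
    (X Y : topologicalType) (theta : gspace K X) (eta : gspace K Y)
    (f : X -> Y) : Prop :=
  gmap theta eta f /\ forall x, isotropy theta x = isotropy eta (f x).

Section Restriction.
Context {G : topologicalGroupType} {X : topologicalType}.
Variables (K : subgroup G) (theta : gspace (full_subgroup G) X).

Let rdom : set (G * X) := [set p | subgroup_set K p.1 /\ pact_dom theta p].

Lemma restrict_domS g x : rdom (g, x) -> subgroup_set K g. Proof. by case. Qed.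

Lemma restrictVK g x : rdom (g, x) ->
  rdom (g^-1, pact theta g x) /\ pact theta g^-1 (pact theta g x) = x.
Proof.
move=> [/= Kg dg]; have [] := pactVK dg.
by split=> //; split=> //=; exact: subgroupV.
Qed.

Lemma restrictM g h x : rdom (h, x) -> rdom (g, pact theta h x) ->
  rdom (g * h, x) /\ pact theta g (pact theta h x) = pact theta (g * h) x.
Proof.
move=> [/= Kh dh] [/= Kg dg]; have [] := pactM dh dg.
by split=> //; split=> //=; exact: subgroupM.
Qed.

Lemma restrict1 x : rdom (1, x) /\ pact theta 1 x = x.
Proof.
by have [] := pact1 theta x; split=> //; split=> //=; exact: subgroup1.
Qed.

Definition restrict_pact : partial_action K X :=
  PartialAction restrict_domS restrictVK restrictM restrict1.

Lemma restrict_range g : subgroup_set K g ->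
  pact_range restrict_pact g = pact_range theta g.
Proof.
move=> Kg; apply/seteqP; split=> x /=; rewrite /pact_range/=; first by case.
by split=> //=; exact: subgroupV.
Qed.

Lemma restrict_open g : subgroup_set K g -> open (pact_range restrict_pact g).
Proof. by move=> Kg; rewrite restrict_range//; exact: gspace_open. Qed.

Lemma restrict_homeo g : subgroup_set K g ->
  homeomorphism_on (pact_range restrict_pact g^-1) (pact_range restrict_pact g)
    (pact restrict_pact g).
Proof.
move=> Kg; rewrite !restrict_range//; last exact: subgroupV.
exact: (gspace_homeo theta).
Qed.

Lemma restrict_continuous : {within pact_dom restrict_pact,
  continuous (fun p : G * X => pact restrict_pact p.1 p.2)}.
Proof.
have h : rdom `<=` pact_dom theta by move=> p [].
exact: (continuous_subspaceW h (@gspace_continuous _ _ _ theta)).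
Qed.

Definition restrict_gspace : gspace K X :=
  GSpace restrict_open restrict_homeo restrict_continuous.

End Restriction.

Section TwistedProduct.
Context {G : topologicalGroupType} {K : subgroup G} {X : topologicalType}.
Variable theta : gspace K X.

Definition twisted_rel : rel (G * X) := fun p q =>
  `[< exists2 k, pact_dom theta (k, p.2) &
      q = (p.1 * k^-1, pact theta k p.2) >].

Lemma twisted_rel_refl : reflexive twisted_rel.
Proof.
move=> [g x]; apply/asboolP; exists 1; have [d e] := pact1 theta x => //=.
by rewrite e invg1 mulg1.
Qed.

Lemma twisted_rel_sym : symmetric twisted_rel.
Proof.
suff H p q : twisted_rel p q -> twisted_rel q p.
  by move=> p q; apply/idP/idP; exact: H.
move=> /asboolP[k dk ->]; apply/asboolP.
exists k^-1; have [d e] := pactVK dk => //=.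
by rewrite e invgK mulgVK; case: p dk d e.
Qed.

Lemma twisted_rel_trans : transitive twisted_rel.
Proof.
move=> q p r /asboolP[k dk ->] /asboolP[l /= dl ->]; apply/asboolP.
have [d e] := pactM dk dl; exists (l * k) => //=.
by rewrite e invgM mulgA.
Qed.

Canonical twisted_equiv :=
  EquivRel twisted_rel twisted_rel_refl twisted_rel_sym twisted_rel_trans.

Definition twisted : topologicalType :=
  quotient_topology {eq_quot twisted_equiv}.

(* [g, x]_K *)
Definition twisted_class (p : G * X) : twisted :=
  \pi_(quotient_topology {eq_quot twisted_equiv}) p.

Lemma twisted_classP p q : twisted_class p = twisted_class q <->
  exists2 k, pact_dom theta (k, p.2) & q = (p.1 * k^-1, pact theta k p.2).
Proof.
split=> [/(@eqmodP _ twisted_equiv)/asboolP//|h].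
by apply/(@eqmodP _ twisted_equiv)/asboolP.
Qed.

Lemma twisted_class_repr (z : twisted) : twisted_class (repr z) = z.
Proof. exact: reprK. Qed.

Lemma twisted_class_continuous : continuous twisted_class.
Proof. exact: pi_continuous. Qed.

Lemma twisted_openE (U : set twisted) : open U = open (twisted_class @^-1` U).
Proof. by []. Qed.

Lemma twisted_class_open (V : set (G * X)) : open V ->
  open (twisted_class @` V).
Proof.
move=> oV; rewrite twisted_openE openE => q [p Vp /twisted_classP[k dk qE]].
have [_ [_ _ _ _ [ct _]]] := gspace_homeo theta (subgroupV (pact_domS dk)).
rewrite invgK in ct.
have oXk := gspace_open theta (pact_domS dk).
have [dk' e] := pactVK dk.
have ck : {for q.2, continuous (pact theta k^-1)}.
  move: ct; rewrite continuous_open_subspace// => /(_ q.2); apply.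
  by rewrite inE qE.
pose f (r : G * X) := (r.1 * k, pact theta k^-1 r.2).
have cf : {for q, continuous f}.
  apply: cvg_pair => /=.
    apply: (@continuous_comp _ _ _ (fun r : G * X => (r.1, k))
      (fun r : G * G => r.1 * r.2)); last exact: mulg_continuous.
    by apply: cvg_pair => /=; [exact: cvg_fst|exact: cvg_cst].
  apply: (@continuous_comp _ _ _ (@snd G X) (pact theta k^-1) q) => //.
  exact: cvg_snd.
have fq : f q = p by rewrite /f qE/= e mulgVK; case: (p).
have nV : nbhs (f q) V by rewrite fq; exact: open_nbhs_nbhs.
have nX : nbhs q (fun r : G * X => pact_range theta k r.2).
  apply: (@cvg_snd _ _ (nbhs q.1) (nbhs q.2)); apply: open_nbhs_nbhs; split=> //.
  by rewrite qE.
near=> r; have Vr : V (f r) by near: r; exact: cf.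
exists (f r) => //; apply/esym/twisted_classP.
exists k^-1; first by near: r.
by rewrite invgK.
Unshelve. all: by end_near. Qed.

(* mu^theta_K; by twisted_actE below it maps (g', [g, x]_K) to [g' g, x]_K. *)
Definition twisted_act (g : G) (z : twisted) : twisted :=
  twisted_class (g * (repr z).1, (repr z).2).

Lemma twisted_actE g h x :
  twisted_act g (twisted_class (h, x)) = twisted_class (g * h, x).
Proof.
have /esym/twisted_classP[k dk e] := twisted_class_repr (twisted_class (h, x)).
by apply/esym/twisted_classP; exists k; rewrite // e /= mulgA.
Qed.

Lemma twisted_act_pair_continuous :
  continuous (fun p : G * twisted => twisted_act p.1 p.2).
Proof.
move=> [g z] W /= nW.
have [U [oU Uz] UW] : exists2 U : set twisted,
    open_nbhs (twisted_act g z) U & U `<=` W.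
  by move: nW; rewrite (@nbhsE twisted).
apply: filterS UW _.
have : nbhs (g * (repr z).1, (repr z).2) (twisted_class @^-1` U).
  by apply: open_nbhs_nbhs; split.
move=> [[A C]] /= [nA nC] AC.
have [[A1 A2] /= [nA1 nA2] A12] := @mulg_continuous G (g, (repr z).1) _ nA.
have nV : nbhs z (twisted_class @` (A2° `*` C°)).
  apply: (@open_nbhs_nbhs twisted); split.
    apply: twisted_class_open; rewrite openE => -[b c] [/= bA cC].
    by exists (A2°, C°) => //; split; exact/nbhs_interior.
  by exists (repr z); [split|exact: twisted_class_repr].
exists (A1, twisted_class @` (A2° `*` C°)) => //=.
move=> [a _] [/= A1a [[b c] [/= A2b Cc] <-]].
rewrite twisted_actE; apply: (AC (a * b, c)); split=> /=.
  by apply: (A12 (a, b)); split=> //=; exact: interior_subset.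
exact: interior_subset.
Qed.

Lemma twisted_actVK g z : twisted_act g^-1 (twisted_act g z) = z.
Proof.
by rewrite -(twisted_class_repr z); case: (repr z) => h x;
  rewrite (twisted_actE g h) twisted_actE mulKg.
Qed.

Lemma twisted_actM g h z :
  twisted_act g (twisted_act h z) = twisted_act (g * h) z.
Proof.
by rewrite -(twisted_class_repr z); case: (repr z) => k x;
  rewrite (twisted_actE h k) !twisted_actE mulgA.
Qed.

Lemma twisted_act1 z : twisted_act 1 z = z.
Proof.
by rewrite -(twisted_class_repr z); case: (repr z) => k x;
  rewrite twisted_actE mul1g.
Qed.

Definition twisted_pact : partial_action (full_subgroup G) twisted.
Proof.
by refine (@PartialAction _ (full_subgroup G) _ [set: G * twisted] twisted_act
  (fun _ _ _ => I) (fun g z _ => conj I (twisted_actVK g z))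
  (fun g h z _ _ => conj I (twisted_actM g h z))
  (fun z => conj I (twisted_act1 z))).
Defined.

Lemma twisted_act_continuous g : continuous (twisted_act g).
Proof.
move=> z; apply: (@continuous_comp _ _ _ (fun z : twisted => (g, z))
  (fun p : G * twisted => twisted_act p.1 p.2)).
  by apply: (@cvg_pair _ _ _ (nbhs z) (nbhs g) (nbhs z)); [exact: cvg_cst|].
by have := twisted_act_pair_continuous; exact.
Qed.

Lemma twisted_homeo g : subgroup_set (full_subgroup G) g ->
  homeomorphism_on (pact_range twisted_pact g^-1) (pact_range twisted_pact g)
    (pact twisted_pact g).
Proof.
move=> _; exists (twisted_act g^-1); split=> // [z _|z _|].
- exact: (twisted_actVK g z).
- by have := twisted_actVK g^-1 z; rewrite invgK.
- split; apply: continuous_subspaceT => z; exact: (@twisted_act_continuous _ z).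
Qed.

Definition twisted_gspace : gspace (full_subgroup G) twisted :=
  @GSpace _ (full_subgroup G) _ twisted_pact (fun _ _ => openT) twisted_homeo
    (continuous_subspaceT twisted_act_pair_continuous).

(* iota^theta_K *)
Definition twisted_iota (x : X) : twisted := twisted_class (1, x).

End TwistedProduct.

Section EnvelopingSpace.
Context {G : topologicalGroupType} {X : topologicalType}.
Variable theta : gspace (full_subgroup G) X.

Definition enveloping_rel : rel (G * X) := fun p q =>
  `[< pact_range theta (p.1^-1 * q.1) p.2 /\
      pact theta (q.1^-1 * p.1) p.2 = q.2 >].

Lemma enveloping_relE : enveloping_rel = twisted_rel theta.
Proof.
apply/funext => -[g x]; apply/funext => -[h y]; apply/asbool_equiv_eq.
rewrite /pact_range/= invgM invgK; split=> [[d e]|[k d [-> ->]]].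
  by exists (h^-1 * g); rewrite // invgM invgK mulgA mulgV mul1g e.
by rewrite invgM invgK mulgVK.
Qed.

Lemma enveloping_rel_refl : reflexive enveloping_rel.
Proof. rewrite enveloping_relE; exact: twisted_rel_refl. Qed.

Lemma enveloping_rel_sym : symmetric enveloping_rel.
Proof. rewrite enveloping_relE; exact: twisted_rel_sym. Qed.

Lemma enveloping_rel_trans : transitive enveloping_rel.
Proof. rewrite enveloping_relE; exact: twisted_rel_trans. Qed.

Canonical enveloping_equiv := EquivRel enveloping_rel
  enveloping_rel_refl enveloping_rel_sym enveloping_rel_trans.

(* X_G *)
Definition enveloping : topologicalType :=
  quotient_topology {eq_quot enveloping_equiv}.

Definition enveloping_class (p : G * X) : enveloping :=
  \pi_(quotient_topology {eq_quot enveloping_equiv}) p.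

Definition enveloping_iota (x : X) : enveloping := enveloping_class (1, x).

End EnvelopingSpace.

(* Main.v *)
Require Import Defs.
From HB Require Import structures.
From mathcomp Require Import all_boot all_order all_algebra.
From mathcomp Require Import all_classical all_reals topology.

(** A class [[g, x]_K] meets the slice [{e} x X] exactly when [(g, x)] lies in
    [K*X], and then only in [(e, g.x)]. So the preimage of [iota(X)] under the
    quotient map is [K*X], which gives (i); and the inverse of [iota] is induced
    by the action map [K*X -> X], hence is continuous because that map is and
    the quotient map is open. *)

Local Open Scope classical_set_scope.
Local Open Scope group_scope.

Section TwistedIota.
Context {G : topologicalGroupType} {K : subgroup G} {X : topologicalType}.
Variable theta : gspace K X.

(** Any [k] relating [(g, x)] to [(1, y)] satisfies [g * k^-1 = 1], so the first coordinate forces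
    [k = g]. Injectivity, isovariance and the inverse of [iota] all rest on this. *)
Lemma twisted_class_eq_iota g x y :
  twisted_class theta (g, x) = twisted_iota theta y <->
  pact_dom theta (g, x) /\ pact theta g x = y.
Proof.
split=> [/twisted_classP[k /= dk [gk ->]]|[d <-]].
  by rewrite -(mulgVK k g) -gk mul1g.
by apply/twisted_classP; exists g; rewrite //= mulgV.
Qed.

Lemma twisted_iota_inj : injective (twisted_iota theta).
Proof. by move=> x y /twisted_class_eq_iota[_ <-]; have [] := pact1 theta x. Qed.

Lemma preimage_range_twisted_iota :
  twisted_class theta @^-1` range (twisted_iota theta) = pact_dom theta.
Proof.
apply/seteqP; split=> -[g x] /=.
  by move=> [y _ /esym/twisted_class_eq_iota[]].
by exists (pact theta g x) => //; apply/esym/twisted_class_eq_iota.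
Qed.

Lemma twisted_iota_continuous : continuous (twisted_iota theta).
Proof.
move=> x; apply: (@continuous_comp _ _ _ (fun y : X => (1 : G, y))
  (twisted_class theta)); last exact: twisted_class_continuous.
by apply: (@cvg_pair _ _ _ (nbhs x) (nbhs (1 : G)) (nbhs x)); [exact: cvg_cst|].
Qed.

(** Since [g] sends [[1, x]] to [[g, x]], both requirements ask when [[g, x] = iota y]: with
    [y = g.x] for equivariance, with [y = x] for the isotropy groups. *)
Lemma twisted_iota_isovariant :
  isovariant theta (restrict_gspace K (twisted_gspace theta))
    (twisted_iota theta).
Proof.
split=> [|x].
  split=> [|g x d]; first exact: twisted_iota_continuous.
  split; first by split=> //=; exact: pact_domS d.
  by rewrite /= twisted_actE mulg1; apply/twisted_class_eq_iota.
apply/seteqP; split=> g; rewrite /isotropy /= twisted_actE mulg1.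
  by move=> [d e]; split; [split=> //=; exact: pact_domS d|
    exact/twisted_class_eq_iota].
by move=> [_ /twisted_class_eq_iota].
Qed.

Lemma open_range_twisted_iota :
  open (range (twisted_iota theta)) <-> open (pact_dom theta).
Proof. by rewrite -preimage_range_twisted_iota. Qed.

(** The quotient topology is given by its open sets, so closedness goes through complements, with
    which preimages commute. *)
Lemma closed_range_twisted_iota :
  closed (range (twisted_iota theta)) <-> closed (pact_dom theta).
Proof.
by rewrite -!openC -preimage_range_twisted_iota preimage_setC.
Qed.

(** On the range of [iota] the value does not depend on the representative; elsewhere it is a junk
    value of [pact]. *)
Definition twisted_iota_inv (z : twisted theta) : X :=
  pact theta (repr z).1 (repr z).2.

Lemma twisted_iotaK : cancel (twisted_iota theta) twisted_iota_inv.
Proof.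
move=> x; have := twisted_class_repr (twisted_iota theta x).
by rewrite /twisted_iota_inv; case: (repr _) => g y /twisted_class_eq_iota[].
Qed.

Lemma twisted_iota_inv_class g x : pact_dom theta (g, x) ->
  twisted_iota_inv (twisted_class theta (g, x)) = pact theta g x.
Proof.
move=> d; have /twisted_class_eq_iota-> := conj d (erefl (pact theta g x)).
exact: twisted_iotaK.
Qed.

Lemma twisted_iota_inv_continuous :
  {within range (twisted_iota theta), continuous twisted_iota_inv}.
Proof.
apply/subspace_continuousP => _ [x _ <-] W; rewrite /from_subspace twisted_iotaK => nW.
have [d1 e1] := pact1 theta x.
(* The action is continuous at [(1, x)] with value [x]: this yields an open [V] around [(1, x)]
   whose points in [K*X] are sent into [W]. *)
have /subspace_continuousP := @gspace_continuous _ _ _ theta.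
move=> /(_ (1, x) d1 W); rewrite /from_subspace /= e1 => /(_ nW).
rewrite /fmap /within /= nbhsE => -[V [oV V1] VW].
(* As the quotient map is open, the image of [V] is the required neighbourhood; a point of it in the
   range of [iota] has its representative from [V] in [K*X]. *)
have : nbhs (twisted_iota theta x) (twisted_class theta @` V).
  by apply: open_nbhs_nbhs; split; [exact: twisted_class_open|exists (1, x)].
apply: filterS => _ [[g y] /VW Wgy <-] rgy /=.
have d : pact_dom theta (g, y) by rewrite -preimage_range_twisted_iota.
by rewrite twisted_iota_inv_class//; exact: Wgy.
Qed.

Lemma twisted_iota_homeo :
  homeomorphism_on [set: X] (range (twisted_iota theta)) (twisted_iota theta).
Proof.
exists twisted_iota_inv; split=> //.
- by move=> x _; exact: twisted_iotaK.
- by move=> _ /set_mem[x _ <-]; rewrite twisted_iotaK.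
- split; last exact: twisted_iota_inv_continuous.
  exact/continuous_subspaceT/twisted_iota_continuous.
Qed.

End TwistedIota.

Section TwistedEnveloping.
Context {G : topologicalGroupType} {X : topologicalType}.
Variable eta : gspace (full_subgroup G) X.

(** The two relations are equal, but their quotients are built as separate types; this transfer of
    equalities makes the maps below, which realise [G x_G X = X_G], well defined on classes. *)
Lemma enveloping_classP p q :
  enveloping_class eta p = enveloping_class eta q <->
  twisted_class eta p = twisted_class eta q.
Proof.
have e := congr1 (fun r => r p q) (enveloping_relE eta).
split=> [/(@eqmodP _ (enveloping_equiv eta))|/(@eqmodP _ (twisted_equiv eta))].
  by rewrite /= e => h; exact/(@eqmodP _ (twisted_equiv eta)).
by rewrite /= -e => h; exact/(@eqmodP _ (enveloping_equiv eta)).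
Qed.

Definition twisted_to_enveloping (z : twisted eta) : enveloping eta :=
  enveloping_class eta (repr z).

Definition enveloping_to_twisted (z : enveloping eta) : twisted eta :=
  twisted_class eta (repr z).

Lemma enveloping_class_repr (z : enveloping eta) :
  enveloping_class eta (repr z) = z.
Proof. exact: reprK. Qed.

Lemma twisted_to_envelopingE p :
  twisted_to_enveloping (twisted_class eta p) = enveloping_class eta p.
Proof. exact/enveloping_classP/twisted_class_repr. Qed.

Lemma enveloping_to_twistedE p :
  enveloping_to_twisted (enveloping_class eta p) = twisted_class eta p.
Proof. exact/enveloping_classP/enveloping_class_repr. Qed.

(** Universal property of the quotient: composed with one quotient map, this map is the other one,
    which is continuous by definition of the topology. *)
Lemma twisted_to_enveloping_continuous : continuous twisted_to_enveloping.
Proof.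
apply/continuousP => U oU; rewrite twisted_openE -comp_preimage.
suff -> : twisted_to_enveloping \o twisted_class eta = enveloping_class eta by [].
by apply/funext => p; exact: twisted_to_envelopingE.
Qed.

Lemma enveloping_to_twisted_continuous : continuous enveloping_to_twisted.
Proof.
apply/continuousP => U oU.
suff : open (enveloping_class eta @^-1` (enveloping_to_twisted @^-1` U)) by [].
rewrite -comp_preimage.
suff -> : enveloping_to_twisted \o enveloping_class eta = twisted_class eta by [].
by apply/funext => p; exact: enveloping_to_twistedE.
Qed.

Lemma twisted_to_enveloping_homeo :
  homeomorphism_on [set: twisted eta] [set: enveloping eta]
    twisted_to_enveloping.
Proof.
exists enveloping_to_twisted; split=> // [z _|z _|].
- by rewrite -(twisted_class_repr z) twisted_to_envelopingE
    enveloping_to_twistedE.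
- by rewrite -(enveloping_class_repr z) enveloping_to_twistedE
    twisted_to_envelopingE.
- split; apply: continuous_subspaceT.
    exact: twisted_to_enveloping_continuous.
  exact: enveloping_to_twisted_continuous.
Qed.

End TwistedEnveloping.

Local Close Scope group_scope.

Theorem proposition3p3 (G : topologicalGroupType) (hG : hausdorff_space G)
    (K : subgroup G) (X : topologicalType) (theta : gspace K X) :
  injective (twisted_iota theta) /\
  isovariant theta (restrict_gspace K (twisted_gspace theta))
    (twisted_iota theta) /\
  ((open (range (twisted_iota theta)) <-> open (pact_dom theta)) /\
   (closed (range (twisted_iota theta)) <-> closed (pact_dom theta))) /\
  homeomorphism_on [set: X] (range (twisted_iota theta)) (twisted_iota theta) /\
  (forall eta : gspace (full_subgroup G) X,
    exists phi : twisted eta -> enveloping eta,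
      [/\ homeomorphism_on [set: twisted eta] [set: enveloping eta] phi,
          forall p, phi (twisted_class eta p) = enveloping_class eta p &
          phi \o twisted_iota eta = enveloping_iota eta]).
Proof.
split; first exact: twisted_iota_inj.
split; first exact: twisted_iota_isovariant.
split; first by split;
  [exact: open_range_twisted_iota|exact: closed_range_twisted_iota].
split=> [|eta]; first exact: twisted_iota_homeo.
exists (twisted_to_enveloping eta); split.
- exact: twisted_to_enveloping_homeo.
- exact: twisted_to_envelopingE.
(* Both canonical maps take the class of [(1, x)]. *)
- by apply/funext => x; exact: twisted_to_envelopingE.
Qed.
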